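(* Let $R$ be a $G$-graded ring, $S\subseteq h(R)$ a multiplicatively closed subset of $R$, $M$ a graded $S$-comultiplication $R$-module, and $N$ a graded submodule of $M$ with $\mathrm{Ann}_R(N)\cap S=\emptyset$. Then the following assertions are equivalent. (i) $N$ is a graded $S$-second submodule of $M$. (ii) $\mathrm{Ann}_R(N)$ is a graded $S$-prime ideal of $R$, and there exists $x\in S$ such that $xN\subseteq \overline{x}N$ for every $\overline{x}\in S$.
   Context: $G$ is a group with identity $e$, and rings are commutative with identity. A $G$-graded ring is $R=\bigoplus_{g\in G}R_g$ with additive subgroups $R_g$ satisfying $R_gR_h\subseteq R_{gh}$; $h(R)=\bigcup_{g}R_g$. A graded $R$-module is $M=\bigoplus_{g\in G}M_g$ with $R_gM_h\subseteq M_{gh}$; $h(M)=\bigcup_g M_g$. A submodule $N$ (resp. ideal $I$) is graded if $N=\bigoplus_g (N\cap M_g)$ (resp. $I=\bigoplus_g(I\cap R_g)$). A nonempty $S\subseteq h(R)$ is multiplicatively closed if $0\notin S$, $1\in S$, and $ab\in S$ for all $a,b\in S$. Notation: $(0:_MP)=\{m\in M: Pm=0\}$ for an ideal $P$, and $\mathrm{Ann}_R(N)=\{r\in R: rN=0\}$. $M$ is a graded $S$-comultiplication module if for each graded submodule $N$ of $M$ there exist $x\in S$ and a graded ideal $P$ of $R$ such that $x(0:_MP)\subseteq N\subseteq (0:_MP)$. A nonzero graded submodule $N$ of $M$ with $\mathrm{Ann}_R(N)\cap S=\emptyset$ is a graded $S$-second submodule if there exists $x\in S$ such that for each $r\in h(R)$,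 $xrN=0$ or $xrN=xN$. A graded ideal $P$ of $R$ with $P\cap S=\emptyset$ is graded $S$-prime if there exists a fixed $x\in S$ such that whenever $ab\in P$ with $a,b\in h(R)$, then $xa\in P$ or $xb\in P$. *)

(* Defs.v *)
From HB Require Import structures.
From mathcomp Require Import all_boot all_order all_algebra.
From mathcomp Require Import mathcomp_extra boolp classical_sets functions.
From mathcomp Require Import cardinality fsbigop.

Set Implicit Arguments.
Unset Strict Implicit.
Unset Printing Implicit Defensive.

Import GRing.Theory.

Local Open Scope classical_set_scope.
Local Open Scope ring_scope.

(* The index group is written multiplicatively and is neither assumed abelian
   nor finite.  Rings are comPzRingType, so that the zero ring is not excluded
   by the type. *)

(* [\sum_(g \in setT) f g] is 0 by convention when [f] has infinite support,
   whence the explicit finiteness condition. *)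
Definition decomposes (I : choiceType) (V : zmodType) (A : I -> set V)
    (v : V) (f : I -> V) : Prop :=
  [/\ finite_set [set i | f i <> 0],
      forall i, A i (f i)
    & v = \sum_(i \in [set: I]) f i].

(* N is the internal direct sum of the additive subgroups A i. *)
Definition direct_sum (I : choiceType) (V : zmodType) (A : I -> set V)
    (N : set V) : Prop :=
  [/\ forall i, zmod_closed [in A i],
      forall v, N v <-> exists f, decomposes A v f
    & forall v f f', decomposes A v f -> decomposes A v f' -> f =1 f'].

Definition graded_ring (G : groupType) (R : comPzRingType)
    (RG : G -> set R) : Prop :=
  direct_sum RG setT /\
  forall g h a b, RG g a -> RG h b -> RG (g * h)%g (a * b).

Definition graded_module (G : groupType) (R : comPzRingType)
    (RG : G -> set R) (M : lmodType R) (MG : G -> set M) : Prop :=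
  direct_sum MG setT /\
  forall g h r m, RG g r -> MG h m -> MG (g * h)%g (r *: m).

Definition homogeneous (G : groupType) (V : zmodType) (A : G -> set V)
    : set V :=
  \bigcup_(g in [set: G]) A g.

Definition graded_submodule (G : groupType) (R : comPzRingType)
    (M : lmodType R) (MG : G -> set M) (N : set M) : Prop :=
  submod_closed [in N] /\ direct_sum (fun g => N `&` MG g) N.

(* The ideals of R are the submodules of the regular module R^o; the unit
   ideal is allowed. *)
Definition graded_ideal (G : groupType) (R : comPzRingType)
    (RG : G -> set R) (P : set R) : Prop :=
  @graded_submodule G R R^o RG P.

Definition mult_closed (G : groupType) (R : comPzRingType)
    (RG : G -> set R) (S : set R) : Prop :=
  [/\ S `<=` homogeneous RG, ~ S 0, S 1
    & forall a b, S a -> S b -> S (a * b)].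

(* (0 :_M P) *)
Definition colon0 (R : comPzRingType) (M : lmodType R) (P : set R) : set M :=
  [set m | forall p, P p -> p *: m = 0].
Arguments colon0 {R} M P.

Definition Ann (R : comPzRingType) (M : lmodType R) (N : set M) : set R :=
  [set r | forall n, N n -> r *: n = 0].

(* The subset r N of M. *)
Definition scale_set (R : comPzRingType) (M : lmodType R) (r : R) (N : set M)
    : set M :=
  [set r *: n | n in N].

Definition graded_S_comultiplication (G : groupType) (R : comPzRingType)
    (RG : G -> set R) (S : set R) (M : lmodType R) (MG : G -> set M) : Prop :=
  forall N : set M, graded_submodule MG N ->
    exists x, S x /\
    exists P : set R, graded_ideal RG P /\
      scale_set x (colon0 M P) `<=` N /\ N `<=` colon0 M P.

Definition graded_S_second (G : groupType) (R : comPzRingType)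
    (RG : G -> set R) (S : set R) (M : lmodType R) (MG : G -> set M)
    (N : set M) : Prop :=
  [/\ graded_submodule MG N,
      N <> [set 0],
      Ann N `&` S = set0
    & exists x, S x /\
      forall r, homogeneous RG r ->
        scale_set (x * r) N = [set 0] \/ scale_set (x * r) N = scale_set x N].

Definition graded_S_prime (G : groupType) (R : comPzRingType)
    (RG : G -> set R) (S : set R) (P : set R) : Prop :=
  [/\ graded_ideal RG P,
      P `&` S = set0
    & exists x, S x /\
      forall a b, homogeneous RG a -> homogeneous RG b -> P (a * b) ->
        P (x * a) \/ P (x * b)].

(* Main.v *)
Require Import Defs.
From mathcomp Require Import all_boot all_order all_algebra.
From mathcomp Require Import mathcomp_extra boolp classical_sets functions.
From mathcomp Require Import cardinality fsbigop finmap.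

Set Implicit Arguments.
Unset Strict Implicit.
Unset Printing Implicit Defensive.

Import GRing.Theory.

Local Open Scope classical_set_scope.
Local Open Scope ring_scope.

(** Write x N for the set of all x n.

    From (i) to (ii), let x witness that N is S-second.  If a b N = 0 and
    x b N is not 0, then x b N = x N, whence x a N = a (x b N) = 0; so the same
    x witnesses that Ann N is S-prime.  For y in S the alternative x y N = 0
    would put x y in both Ann N and S, so x N = x y N, which lies in y N.

    From (ii) to (i), let x0 witness that Ann N is S-prime and let x1 N lie in
    y N for all y in S.  For homogeneous r the submodule r N is graded, so the
    comultiplication hypothesis gives y in S and a graded ideal P with
    y (0 :_M P) <= r N <= (0 :_M P).  Then p r kills N for all p in P.  If x0 r
    does not kill N, primeness forces x0 p N = 0 for every homogeneous p in P,
    hence for every p in P since P is graded; thus x0 N <= (0 :_M P) and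
    x1 N <= y x0 N <= r N.  So either x0 r N = 0 or x1 N <= r N
    ([prime_dichotomy]), and x0 x1 is a witness that N is S-second.

    Two facts on gradings carry this: annihilators of graded submodules are
    graded ideals ([graded_ideal_Ann]), and r N is graded for homogeneous r
    ([graded_submodule_scale]).  In both, multiplication by a homogeneous
    element translates the degrees; translations of a group are bijective, so
    components of distinct degrees stay in distinct degrees and a decomposition
    is carried to a decomposition ([decomposes_reindex]). *)

(** * Decompositions *)

Lemma sum_closed (I : choiceType) (V : zmodType) (K : set V) (f : I -> V) :
  zmod_closed [in K] -> (forall i, K (f i)) -> K (\sum_(i \in [set: I]) f i).
Proof.
move=> Kc Kf; have [_ KD] := GRing.zmod_closedD Kc; have [K0 _] := Kc.
apply: big_ind => //; first by rewrite -in_setE.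
by move=> x y /mem_set Kx /mem_set Ky; rewrite -in_setE; exact: KD.
Qed.

Lemma decomposes0 (I : choiceType) (V : zmodType) (A : I -> set V) :
  (forall i, zmod_closed [in A i]) -> decomposes A 0 (fun=> 0).
Proof.
move=> Ac; split=> [|i|]; last by rewrite fsbig1.
- by rewrite (_ : [set i | _] = set0) //; apply/seteqP; split=> i //=; case.
- by rewrite -in_setE; have [] := Ac i.
Qed.

(** Injectivity of [s] is what makes this work: no two components are merged
    into one piece, so the images are themselves the components of [L v]. *)
Lemma decomposes_reindex (I : choiceType) (V W : zmodType) (A : I -> set V)
    (B : I -> set W) (L : V -> W) (s t : I -> I) (v : V) (f : I -> V) :
  {morph L : x y / x + y} ->
  cancel s t -> cancel t s -> (forall i a, A i a -> B (s i) (L a)) ->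
  decomposes A v f -> decomposes B (L v) (fun i => L (f (t i))).
Proof.
move=> LD st ts AB [fin_f Af ->].
have L0 : L 0 = 0 by apply: (@addrI _ (L 0)); rewrite -LD !addr0.
split=> [|i|].
- apply: (@sub_finite_set _ _ (s @` [set i | f i <> 0])).
    move=> i /= Lf; exists (t i) => /=; last exact: ts.
    by move=> f0; apply: Lf; rewrite f0.
  exact: finite_image.
- by rewrite -{1}(ts i); exact: AB.
- have tbij : bijective t by exists s.
  rewrite -(@reindex_fsbigT _ _ _ _ _ t (fun i => L (f i)) tbij).
  have f0 i : i \notin fset_set [set i | f i <> 0] -> f i = 0.
    rewrite in_fset_set // => /negP nfi; apply: contrapT => fi.
    by apply: nfi; exact: mem_set.
  rewrite (fsbigTE _ _ f0) (big_morph L LD L0).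
  rewrite -(fsbigTE _ (fun i => L (f i))) //.
  by move=> i /f0 ->.
Qed.

(** * Annihilators and multiples of graded submodules *)

Lemma submod_closed_colon0 (R : comPzRingType) (M : lmodType R) (P : set R) :
  submod_closed [in colon0 M P].
Proof.
split=> [|a u v /set_mem Pu /set_mem Pv]; apply/mem_set => p Pp.
  by rewrite scaler0.
by rewrite scalerDr scalerA mulrC -scalerA Pu // Pv // scaler0 addr0.
Qed.

Lemma submod_closed_Ann (R : comPzRingType) (M : lmodType R) (N : set M) :
  @submod_closed R R^o [in Ann N].
Proof.
split=> [|a u v /set_mem Nu /set_mem Nv]; apply/mem_set => n Nn.
  by rewrite scale0r.
by rewrite scalerDl -scalerA Nu // Nv // scaler0 addr0.
Qed.

Lemma submod_closed_scale (R : comPzRingType) (M : lmodType R) (r : R)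
    (N : set M) :
  submod_closed [in N] -> submod_closed [in scale_set r N].
Proof.
move=> [N0 NZD]; split=> [|a _ _ /set_mem[u Nu <-] /set_mem[v Nv <-]].
  by apply/mem_set; exists 0; [exact: set_mem|rewrite scaler0].
apply/mem_set; exists (a *: u + v).
  by apply: set_mem; apply: NZD; exact: mem_set.
by rewrite scalerDr !scalerA mulrC.
Qed.

(** Independence of the pieces is inherited from the ambient grading, so only
    the existence of components inside [K] has to be checked. *)
Lemma graded_submodule_components (G : groupType) (R : comPzRingType)
    (M : lmodType R) (MG : G -> set M) (K : set M) :
  direct_sum MG setT -> submod_closed [in K] ->
  (forall v, K v -> exists f, decomposes (fun g => K `&` MG g) v f) ->
  graded_submodule MG K.
Proof.
move=> [MGc _ MGuniq] Kc Kdec; split=> //; split.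
- move=> g; have [K0 KB] := GRing.submod_closedB Kc; have [A0 AB] := MGc g.
  split=> [|u v]; first by apply/mem_set; split; exact: set_mem.
  move=> /set_mem[/mem_set Ku /mem_set Au] /set_mem[/mem_set Kv /mem_set Av].
  by apply/mem_set; split; apply: set_mem; [exact: KB|exact: AB].
- move=> v; split=> [/Kdec //|[f [_ Kf ->]]].
  by apply: sum_closed (GRing.submod_closedB Kc) _ => g; have [] := Kf g.
- move=> v f f' [ff Kf vf] [ff' Kf' vf']; apply: (MGuniq v).
  + by split=> // g; have [] := Kf g.
  + by split=> // g; have [] := Kf' g.
Qed.

(** For [n] homogeneous of degree h, the components of r n = 0 are the products
    of the components of r with [n], moved by the translation g |-> g h,
    so each of these products is 0. *)
Lemma graded_ideal_Ann (G : groupType) (R : comPzRingType) (RG : G -> set R)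
    (M : lmodType R) (MG : G -> set M) (N : set M) :
  graded_ring RG -> graded_module RG MG -> graded_submodule MG N ->
  graded_ideal RG (Ann N).
Proof.
move=> [RGsum _] [[MGc _ MGuniq] MGM] [_ [_ Ndec _]].
apply: (@graded_submodule_components G R R^o) => //.
  exact: submod_closed_Ann.
move=> r Nr; have [_ RGdec _] := RGsum.
have [f rf] := (RGdec r).1 I; have [fin_f RGf r_sum] := rf.
exists f; split=> // g; split=> // n /Ndec[n_ [_ Nn_ ->]].
(* The elements killed by [f g] form a submodule, so n may be homogeneous. *)
suff: colon0 M [set f g] (\sum_(i \in [set: G]) n_ i) by apply.
apply: sum_closed.
  by apply: GRing.submod_closedB; exact: submod_closed_colon0.
move=> h p ->; have [Nnh MGnh] := Nn_ h.
have dec : decomposes MG (r *: n_ h) (fun k => f (k * h^-1)%g *: n_ h).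
  apply: (@decomposes_reindex _ _ _ RG MG ( *:%R^~ (n_ h))
    (fun k => k * h)%g (fun k => k * h^-1)%g) => //.
  - by move=> a b; rewrite scalerDl.
  - exact: mulgK.
  - exact: mulgVK.
  - by move=> i a RGa; exact: MGM.
rewrite (Nr _ Nnh) in dec.
by have := MGuniq _ _ _ dec (decomposes0 MGc) (g * h)%g; rewrite mulgK.
Qed.

(** The component of r n in degree k is r times the component of n in degree
    g^-1 k, where g is the degree of [r]. *)
Lemma graded_submodule_scale (G : groupType) (R : comPzRingType)
    (RG : G -> set R) (M : lmodType R) (MG : G -> set M) (N : set M) (r : R) :
  graded_module RG MG -> graded_submodule MG N -> homogeneous RG r ->
  graded_submodule MG (scale_set r N).
Proof.
move=> [MGsum MGM] [Nc [_ Ndec _]] [g _ RGr].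
apply: graded_submodule_components => //; first exact: submod_closed_scale.
move=> _ [n /Ndec[f nf] <-].
exists (fun k => r *: f (g^-1 * k)%g).
apply: (@decomposes_reindex _ _ _ _ _ ( *:%R r) (fun k => g * k)%g) nf.
- by move=> a b; rewrite scalerDr.
- exact: mulKg.
- exact: mulVKg.
- by move=> i a [Na MGa]; split; [exists a|exact: MGM].
Qed.

(** The elements of R killing [m] form an ideal, so it is enough to test the
    components of the elements of [P], which again lie in [P]. *)
Lemma colon0_homogeneous (G : groupType) (R : comPzRingType) (RG : G -> set R)
    (M : lmodType R) (P : set R) (m : M) :
  graded_ideal RG P -> (forall p, P p -> homogeneous RG p -> p *: m = 0) ->
  colon0 M P m.
Proof.
move=> [_ [_ Pdec _]] Pm p /Pdec[f [_ Pf ->]].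
suff: Ann [set m] (\sum_(i \in [set: G]) f i) by apply.
apply: (@sum_closed _ R^o).
  by apply: GRing.submod_closedB; exact: submod_closed_Ann.
by move=> i n ->; have [Pfi RGfi] := Pf i; apply: Pm => //; exists i.
Qed.

(** * S-second submodules *)

Lemma scale_set_scale (R : comPzRingType) (M : lmodType R) (a b : R)
    (N : set M) :
  scale_set a (scale_set b N) = scale_set (a * b) N.
Proof.
apply/seteqP; split=> [_ [_ [n Nn <-] <-]|_ [n Nn <-]].
  by exists n => //; rewrite scalerA.
by exists (b *: n); [exists n|rewrite scalerA].
Qed.

Lemma scale_set_sub (R : comPzRingType) (M : lmodType R) (a b : R)
    (N : set M) :
  submod_closed [in N] -> scale_set (a * b) N `<=` scale_set a N.
Proof.
move=> Nc _ [n Nn <-]; exists (b *: n); last by rewrite scalerA.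
apply: set_mem.
have NZ := GRing.subsemimod_closedZ (GRing.submod_closed_semi Nc).
by apply: NZ; exact: mem_set.
Qed.

Lemma scale_set_eq0 (R : comPzRingType) (M : lmodType R) (r : R) (N : set M) :
  submod_closed [in N] -> scale_set r N = [set 0] <-> Ann N r.
Proof.
move=> [/set_mem N0 _]; split=> [rN n Nn|rN].
  by have : scale_set r N (r *: n) by [exists n]; rewrite rN.
apply/seteqP; split=> [_ [n Nn <-]|_ ->]; first exact: rN.
by exists 0 => //; rewrite scaler0.
Qed.

Lemma second_Ann_prime (G : groupType) (R : comPzRingType) (RG : G -> set R)
    (S : set R) (M : lmodType R) (MG : G -> set M) (N : set M) :
  graded_ring RG -> graded_module RG MG -> graded_S_second RG S MG N ->
  graded_S_prime RG S (Ann N).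
Proof.
move=> hR hM [hN _ hAnn [x [Sx xsecond]]]; have [Nc _] := hN.
split=> //; first exact: graded_ideal_Ann hR hM hN.
exists x; split=> // a b _ hb Nab.
have [/(scale_set_eq0 _ Nc) Nxb|xbN] := xsecond b hb; [by right|left].
move=> n Nn; have : scale_set x N (x *: n) by exists n.
rewrite -xbN => -[m Nm xbm].
by rewrite mulrC -scalerA -xbm scalerA mulrCA -scalerA Nab // scaler0.
Qed.

Lemma second_scale_sub (G : groupType) (R : comPzRingType) (RG : G -> set R)
    (S : set R) (M : lmodType R) (MG : G -> set M) (N : set M) :
  mult_closed RG S -> graded_S_second RG S MG N ->
  exists x, S x /\ forall y, S y -> scale_set x N `<=` scale_set y N.
Proof.
move=> [Shom _ _ SM] [[Nc _] _ hAnn [x [Sx xsecond]]].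
exists x; split=> // y Sy.
have [/(scale_set_eq0 _ Nc) Nxy|<-] := xsecond y (Shom _ Sy).
  have : (Ann N `&` S) (x * y) by split=> //; exact: SM.
  by rewrite hAnn.
by rewrite mulrC; exact: scale_set_sub.
Qed.

(** Comultiplication says that r N is (0 :_M P) up to an element y of S; this
    turns the inclusion of x1 N in r N into a statement on annihilators, where
    primeness applies. *)
Lemma prime_dichotomy (G : groupType) (R : comPzRingType) (RG : G -> set R)
    (S : set R) (M : lmodType R) (MG : G -> set M) (N : set M) (x0 x1 r : R) :
  mult_closed RG S -> graded_module RG MG ->
  graded_S_comultiplication RG S MG -> graded_submodule MG N ->
  S x0 ->
  (forall a b, homogeneous RG a -> homogeneous RG b -> Ann N (a * b) ->
    Ann N (x0 * a) \/ Ann N (x0 * b)) ->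
  (forall y, S y -> scale_set x1 N `<=` scale_set y N) ->
  homogeneous RG r ->
  Ann N (x0 * r) \/ scale_set x1 N `<=` scale_set r N.
Proof.
move=> [_ _ _ SM] hM hcomult hN Sx0 x0prime x1min hr.
have [y [Sy [P [hP [yPr rP]]]]] :=
  hcomult _ (graded_submodule_scale hM hN hr).
have [|Nx0r] := pselect (Ann N (x0 * r)); [by left|right].
suff x0P : scale_set x0 N `<=` colon0 M P.
  apply: subset_trans (x1min _ (SM _ _ Sy Sx0)) _.
  by rewrite -scale_set_scale; apply: subset_trans yPr; exact: image_subset.
move=> _ [n Nn <-]; apply: (colon0_homogeneous hP) => p Pp hp.
have Npr : Ann N (p * r).
  by move=> k Nk; rewrite -scalerA; apply: rP => //; exists k.
have [Nx0p|//] := x0prime p r hp hr Npr.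
by rewrite scalerA mulrC; exact: Nx0p.
Qed.

Lemma Ann_prime_second (G : groupType) (R : comPzRingType) (RG : G -> set R)
    (S : set R) (M : lmodType R) (MG : G -> set M) (N : set M) (x1 : R) :
  mult_closed RG S -> graded_module RG MG ->
  graded_S_comultiplication RG S MG -> graded_submodule MG N ->
  graded_S_prime RG S (Ann N) -> S x1 ->
  (forall y, S y -> scale_set x1 N `<=` scale_set y N) ->
  graded_S_second RG S MG N.
Proof.
move=> hS hM hcomult hN [_ hAnn [x0 [Sx0 x0prime]]] Sx1 x1min.
have [Nc _] := hN; have [_ _ S1 SM] := hS.
split=> //.
  move=> N0; have : (Ann N `&` S) 1.
    by split=> // n; rewrite N0 => ->; rewrite scaler0.
  by rewrite hAnn.
exists (x0 * x1); split=> [|r hr]; first exact: SM.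
have [Nx0r|x1r] :=
  prime_dichotomy hS hM hcomult hN Sx0 x0prime x1min hr; [left|right].
  apply/(scale_set_eq0 _ Nc) => n Nn.
  by rewrite mulrAC mulrC -scalerA Nx0r // scaler0.
apply/seteqP; split; first exact: scale_set_sub.
(* x1 N lies in y N for all y in S; the choice y = (x0 x1) x1 gives
   x0 x1 N <= x1 N <= (x0 x1) x1 N <= (x0 x1) r N. *)
rewrite {1}(mulrC x0 x1); apply: (subset_trans (scale_set_sub Nc)).
apply: subset_trans (x1min _ (SM _ _ (SM _ _ Sx0 Sx1) Sx1)) _.
by rewrite -!(scale_set_scale (x0 * x1)); exact: image_subset.
Qed.

Theorem theorem3p28 (G : groupType) (R : comPzRingType) (RG : G -> set R)
    (hR : graded_ring RG) (S : set R) (hS : mult_closed RG S)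
    (M : lmodType R) (MG : G -> set M) (hM : graded_module RG MG)
    (hcomult : graded_S_comultiplication RG S MG)
    (N : set M) (hN : graded_submodule MG N) (hAnn : Ann N `&` S = set0) :
  graded_S_second RG S MG N <->
  (graded_S_prime RG S (Ann N) /\
   exists x, S x /\
     forall xbar, S xbar -> scale_set x N `<=` scale_set xbar N).
Proof.
split=> [hsecond|[hprime [x1 [Sx1 x1min]]]].
  by split; [exact: second_Ann_prime hsecond|exact: second_scale_sub hsecond].
exact: Ann_prime_second hprime Sx1 x1min.
Qed.
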